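(* Let $\mu,\lambda$ be cardinals, $\delta$ an ordinal, and assume: (a) $\mu<{\rm cf}(\lambda)<\lambda$; (b) $\langle\lambda_i:i<\delta\rangle$ is a strictly increasing sequence of regular cardinals with limit $\mu$; (c) $J$ is an ideal on $\delta$ containing all bounded subsets of $\delta$, and $A\subseteq\delta$ satisfies $A\notin J$ and $\delta\setminus A\notin J$; (d) $\langle g_\alpha:\alpha<{\rm cf}(\lambda)\rangle$ is a $<_{J\restriction A}$-increasing and $<_{J\restriction A}$-cofinal sequence of members of $\prod_{i\in A}\lambda_i$, and $\langle h_\alpha:\alpha<\lambda\rangle$ is a sequence of pairwise distinct members of $\prod_{i\in\delta\setminus A}\lambda_i$ such that for every $j<\delta$, $|\{h_\alpha\restriction j,\ g_\beta\restriction j:\alpha<\lambda,\ \beta<{\rm cf}(\lambda)\}|<\lambda_j$. Then there is a Boolean algebra ${\mathbb B}$ such that $|{\mathbb B}|=\lambda=s({\mathbb B})$, $s^+({\mathbb B})=\lambda$, and ${\rm hd}^+({\mathbb B})={\rm hL}^+({\mathbb B})=\lambda$.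
   Context: $J\restriction A=\{X\subseteq A:X\in J\}$; for $f,g\in\prod_{i\in A}\lambda_i$, $f<_{J\restriction A}g$ means $\{i\in A:f(i)\ge g(i)\}\in J$; a sequence is $<_{J\restriction A}$-cofinal if every $f\in\prod_{i\in A}\lambda_i$ is $<_{J\restriction A}$-below some member. For a Boolean algebra ${\mathbb B}$: $s({\mathbb B})$ is the supremum of the cardinals $\theta$ for which there is a sequence $\langle a_\alpha:\alpha<\theta\rangle$ of nonzero elements such that no $a_\alpha$ lies in the ideal generated by $\{a_\beta:\beta\ne\alpha\}$; $s^+({\mathbb B})$ is the least $\theta$ for which no such sequence of length $\theta$ exists. ${\rm hd}^+({\mathbb B})$ (resp. ${\rm hL}^+({\mathbb B})$) is the least $\theta$ for which there is no sequence $\langle a_\alpha:\alpha<\theta\rangle$ of nonzero elements with each $a_\alpha$ not in the ideal generated by $\{a_\beta:\beta<\alpha\}$ (resp. $\{a_\beta:\beta>\alpha\}$). *)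

(* Defs.v *)
(* MathComp, with the classical sets and cardinalities of MathComp-Analysis. *)
From HB Require Import structures.
From mathcomp Require Import all_boot all_order.
From mathcomp Require Import boolp classical_sets functions cardinality wochoice.

Set Implicit Arguments.
Unset Strict Implicit.
Unset Printing Implicit Defensive.

Local Open Scope classical_set_scope.
Local Open Scope order_scope.
Local Open Scope card_scope.

(* An ordinal is a well-ordered type, standing for its order type; a cardinal
   is an initial ordinal.  Cardinals are compared by [#<=] and [#=] on their
   carriers. *)
Record ordinalType := OrdinalType {
  ordinal_disp : Order.disp_t;
  ordinal_sort :> orderType ordinal_disp;
  ordinal_wo : well_order (<=%O : rel ordinal_sort) }.

Definition card_lt T U (A : set T) (B : set U) : Prop :=
  A #<= B /\ ~ (B #<= A).
Notation "A '#<' B" := (card_lt A B) (at level 79) : card_scope.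

Record cardinalType := CardinalType {
  cardinal_ordinal :> ordinalType;
  cardinal_initial : forall x : cardinal_ordinal,
    [set y : cardinal_ordinal | y < x] #< [set: cardinal_ordinal] }.

Definition least_cardinal (P : cardinalType -> Prop) (k : cardinalType) : Prop :=
  P k /\ forall t : cardinalType, P t -> [set: k] #<= [set: t].

Definition sup_cardinal (P : cardinalType -> Prop) : cardinalType -> Prop :=
  least_cardinal (fun k => forall t, P t -> [set: t] #<= [set: k]).

Definition cofinality (L : ordinalType) : cardinalType -> Prop :=
  least_cardinal (fun k => exists f : k -> L, forall x, exists a, x <= f a).

Definition regular_cardinal (k : cardinalType) : Prop :=
  [set: nat] #<= [set: k] /\ cofinality k k.

(* Applied both to Boolean algebras and to the lattice [set D], whose order is
   inclusion: an ideal on D is an ideal of that lattice. *)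
Definition is_ideal d (L : bDistrLatticeType d) (I : set L) : Prop :=
  [/\ I \bot,
      forall x y, x <= y -> I y -> I x
    & forall x y, I x -> I y -> I (x `|` y)].

Definition ideal_generated d (L : bDistrLatticeType d) (S : set L) : set L :=
  smallest (@is_ideal d L) S.

Section Products.
Variables (D : ordinalType) (lam : D -> cardinalType).

Definition prod_on (A : set D) := forall i : A, lam (val i).

(* [f |` j] as a partial function on D: its value is None outside of
   {i in A | i < j}. *)
Definition restr (A : set D) (f : prod_on A) (j : D) :
    forall i : D, option (lam i) :=
  fun i => match pselect (i \in A) with
           | left iA => if i < j then Some (f (exist _ i iA)) else None
           | right _ => None
           end.

Definition lt_mod (J : set (set D)) (A : set D) (f g : prod_on A) : Prop :=
  J [set val i | i in [set i : A | g i <= f i]].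

End Products.

Section CardinalFunctions.
Variables (d : Order.disp_t) (B : ctbDistrLatticeType d).

(* A sequence of nonzero elements with no a_x in the ideal generated by the
   a_y such that R y x. *)
Definition ideal_free (T : Type) (R : T -> T -> Prop) (a : T -> B) : Prop :=
  forall x, a x != \bot /\
    ~ ideal_generated [set a y | y in [set y | R y x]] (a x).

Definition has_s_seq (t : cardinalType) : Prop :=
  exists a : t -> B, ideal_free (fun y x => y <> x) a.
Definition has_hd_seq (t : cardinalType) : Prop :=
  exists a : t -> B, ideal_free (fun y x => y < x) a.
Definition has_hL_seq (t : cardinalType) : Prop :=
  exists a : t -> B, ideal_free (fun y x => x < y) a.

Definition is_s : cardinalType -> Prop := sup_cardinal has_s_seq.
Definition is_s_plus : cardinalType -> Prop :=
  least_cardinal (fun t => ~ has_s_seq t).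
Definition is_hd_plus : cardinalType -> Prop :=
  least_cardinal (fun t => ~ has_hd_seq t).
Definition is_hL_plus : cardinalType -> Prop :=
  least_cardinal (fun t => ~ has_hL_seq t).

End CardinalFunctions.

(* Main.v *)
Require Import Defs.
From HB Require Import structures.
From mathcomp Require Import all_boot all_order.
From mathcomp Require Import boolp classical_sets functions cardinality wochoice.
From mathcomp Require Import filter.

(* Let block : lambda -> cf lambda have bounded fibres, let f_a be the union of
   g_(block a) and h_a, and let
     gen a = {a} U {b : f_a, f_b first differ at some i in A, f_a i < f_b i}.
   The algebra is the one generated by the sets gen a in the power set of
   lambda.  Within one block the f_a agree on A, so the generators are ideal
   independent; blocks have unbounded sizes, which gives sequences of every
   length < lambda.

   Conversely, separate a sequence of length lambda by ultrafilters U_n on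
   lambda.  A set gen a^(+-) in U either can be shrunk, inside U, to one of at
   most mu many sets (because it depends only on the restriction f_a | i outside
   of the cone of f_a | i), or all cones of f_a belong to U, and there is at most
   one such a.  So each member of the sequence is described by a label from a
   set of size mu < cf lambda together with a single index.  Some label occurs
   with unbounded indices in every tail; since the g's are cofinal, its indices
   contain a zigzag a1, a2, a3 with first differences at the same i in A, going
   up and then down, and this refutes left and right separation alike. *)

Set Implicit Arguments.
Unset Strict Implicit.
Unset Printing Implicit Defensive.

Import Order.TTheory.

Local Open Scope classical_set_scope.
Local Open Scope order_scope.
Local Open Scope card_scope.

(** * Cardinals *)

Definition injects (T U : Type) : Prop := exists f : T -> U, injective f.

Lemma injects_refl T : injects T T.
Proof. by exists id. Qed.

Lemma injects_trans T U V : injects T U -> injects U V -> injects T V.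
Proof. by move=> [f fI] [g gI]; exists (g \o f); exact: inj_comp. Qed.

Lemma injects_prod T T' U U' :
  injects T U -> injects T' U' -> injects (T * T') (U * U').
Proof.
move=> [f fI] [g gI]; exists (fun p => (f p.1, g p.2)).
by move=> [a b] [a' b'] /= [/fI -> /gI ->].
Qed.

Lemma injects_sig T (P : T -> Prop) : injects {x | P x} T.
Proof. by exists sval => x y; exact: eq_sig_hprop. Qed.

Lemma injects_surj T U (f : T -> U) : (forall u, exists t, f t = u) -> injects U T.
Proof.
move=> fS; exists (fun u => sval (cid (fS u))) => u v e.
by rewrite -(svalP (cid (fS u))) e (svalP (cid (fS v))).
Qed.

Lemma card_le_injects T U (A : set T) (B : set U) :
  (A #<= B) <-> injects {x | A x} {x | B x}.
Proof.
have memP V (C : set V) x : x \in C -> C x by move/set_mem.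
split=> [/card_leP[f]|[f fI]].
- exists (fun x => let y := f (exist _ (sval x) (mem_set (svalP x))) in
                   exist _ (sval y) (memP _ _ _ (svalP y))).
  move=> x y /(congr1 sval) /= /val_inj e.
  have /(congr1 val) /= := 'inj_f (mem_setT _) (mem_setT _) e.
  exact: eq_sig_hprop.
- apply/card_leP/injfunPex.
  exists (fun x : A => let y := f (exist _ (val x) (memP _ _ _ (valP x))) in
                   (exist _ (sval y) (mem_set (svalP y)) : B)) => //.
  move=> x y _ _ /(congr1 val) /= e; apply/val_inj.
  have /fI /(congr1 sval) // :
    f (exist _ (val x) (memP _ _ _ (valP x))) = f (exist _ (val y) (memP _ _ _ (valP y))).
  exact: eq_sig_hprop.
Qed.

Lemma injects_sigT T : injects T {x : T | [set: T] x}.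
Proof. by exists (fun x => exist _ x I) => x y []. Qed.

Lemma card_leTT T U : ([set: T] #<= [set: U]) <-> injects T U.
Proof.
rewrite card_le_injects; split=> h.
- apply: injects_trans (injects_sigT T) _; apply: injects_trans h _.
  exact: injects_sig.
- apply: injects_trans (injects_sig _) _; apply: injects_trans h _.
  exact: injects_sigT.
Qed.

Lemma card_leT_injects T U (B : set U) : ([set: T] #<= B) <-> injects T {x | B x}.
Proof.
rewrite card_le_injects; split=> h.
- exact: injects_trans (injects_sigT T) h.
- exact: injects_trans (injects_sig _) h.
Qed.

Lemma injects_nat_infinite T : injects nat T <-> infinite_set [set: T].
Proof. by rewrite infiniteP card_leTT. Qed.

(** * Greedy transfinite recursion *)

Section Greedy.
Variables (W : Type) (R : W -> W -> Prop).
Hypothesis R_wf : well_founded R.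
Hypothesis R_total : forall x y, [\/ R x y, x = y | R y x].

Lemma greedy_injects X :
  (forall z, ~ injects X {w | R w z}) -> injects W X.
Proof.
move=> noinj.
pose F z (phi : forall y, R y z -> option X) : option X :=
  match pselect (exists x, forall y (h : R y z), phi y h <> Some x) with
  | left e => Some (sval (cid e))
  | right _ => None end.
pose g := Fix R_wf (fun _ => option X) F.
have gE z : g z = F z (fun y _ => g y).
  apply: Fix_eq => x f f' ff'; congr F.
  by apply: functional_extensionality_dep => y; apply: functional_extensionality_dep.
have gP z : exists2 x, g z = Some x & forall y, R y z -> g y <> Some x.
  rewrite gE /F; case: pselect => [e|/forallNP ne].
    by exists (sval (cid e)) => // y h; exact: (svalP (cid e) y h).
  exfalso; apply: (noinj z).
  have {}ne x : exists w : {w | R w z}, g (sval w) = Some x.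
    apply: contrapT => nw; apply: (ne x) => y h e.
    by apply: nw; exists (exist _ y h).
  exists (fun x => sval (cid (ne x))) => x y e.
  by have := svalP (cid (ne x)); rewrite e (svalP (cid (ne y))) => -[].
exists (fun z => s2val (cid2 (gP z))) => z z'.
case: (cid2 (gP z)) => x /= gz nx; case: (cid2 (gP z')) => x' /= gz' nx' e.
case: (R_total z z') => // h; last by case: (nx _ h); rewrite e.
by case: (nx' _ h); rewrite -e.
Qed.

End Greedy.

(** * Least elements and initial segments of ordinals *)

Lemma ord_min (W : ordinalType) (P : W -> Prop) :
  (exists x, P x) -> exists2 x, P x & forall y, P y -> x <= y.
Proof.
move=> [x Px].
have [|z [[zP zmin] _]] := @ordinal_wo W (fun y => `[< P y >]).
  by exists x; apply/asboolP.
exists z; first exact/asboolP.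
by move=> y Py; apply: zmin; apply/asboolP.
Qed.

Lemma ord_wf (W : ordinalType) : well_founded (fun x y : W => x < y).
Proof.
move=> x; apply: contrapT => nx.
have [|z nz zmin] := @ord_min W (fun z => ~ Acc (fun x y : W => x < y) z).
  by exists x.
apply: nz; constructor => y yz; apply: contrapT => /zmin.
by rewrite leNgt yz.
Qed.

Definition seg (W : ordinalType) (z : W) := {x : W | x < z}.

HB.instance Definition _ (W : ordinalType) (z : W) :=
  SubChoice.copy (seg z) {x : W | x < z}.
HB.instance Definition _ (W : ordinalType) (z : W) :=
  [SubChoice_isSubOrder of seg z by <: with ordinal_disp W].

Lemma seg_wo (W : ordinalType) (z : W) : well_order (<=%O : rel (seg z)).
Proof.
apply: antisymmetric_well_order; first exact: le_anti.
move=> A [x Ax].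
have [|y [yz yA] ymin] := @ord_min W (fun y => exists yz : y < z, exist _ y yz \in A).
  by case: x Ax => x xz Ax; exists x, xz.
exists (exist _ y yz); split=> // -[t tz] tA; rewrite leEsub /=.
by apply: ymin; exists tz.
Qed.


Definition seg_ord (W : ordinalType) (z : W) := OrdinalType (@seg_wo W z).

Lemma seg_injects (W : ordinalType) (z : W) : injects (seg z) W.
Proof. by exists val; exact: val_inj. Qed.

Lemma seg_injects_le (W : ordinalType) (y z : W) : y <= z -> injects (seg y) (seg z).
Proof.
move=> yz; exists (fun x : seg y => exist _ (val x) (lt_le_trans (svalP x) yz) : seg z).
by move=> a b /(congr1 val) /= /val_inj.
Qed.

Lemma seg_seg_injects (W : ordinalType) (z : W) (y : seg_ord z) :
  injects (seg y) (seg (val y)).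
Proof.
exists (fun x : seg y => exist _ (val (val x)) (svalP x) : seg (val y)).
by move=> a b /(congr1 val) /= /val_inj /val_inj.
Qed.

Lemma seg_injects_seg (W : ordinalType) (z : W) (y : seg_ord z) :
  injects (seg (val y)) (seg y).
Proof.
exists (fun x : seg (val y) => exist (fun x : seg_ord z => x < y)
  (exist (fun x : W => x < z) (val x) (lt_trans (svalP x) (svalP y))) (svalP x)).
by move=> a b /(congr1 (val \o val)) /= /val_inj.
Qed.

(** * Squares of infinite cardinals *)

Lemma hotel T : injects nat T -> injects (option T) T.
Proof.
move=> [f fI].
pose next x := match pselect (exists n, f n = x) with
  | left e => f (sval (cid e)).+1 | right _ => x end.
have nextP x : (exists2 n, f n = x & next x = f n.+1) \/
    ((forall n, f n <> x) /\ next x = x).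
  rewrite /next; case: pselect => [e|/forallNP ne]; last by right.
  by left; exists (sval (cid e)) => //; exact: (svalP (cid e)).
exists (fun o => if o is Some x then next x else f 0%N).
move=> [x|] [y|] //.
- move=> e; congr Some; move: e.
  case: (nextP x) => [[n <- ->]|[nx ->]]; case: (nextP y) => [[m <- ->]|[ny ->]] //.
  + by move/fI => [->].
  + by move/ny.
  + by move/esym/nx.
- by case: (nextP x) => [[n _ ->] /fI|[nx ->] /esym/nx].
- by case: (nextP y) => [[n _ ->] /fI|[ny ->] /ny].
Qed.

Section Goedel.
Variable W : ordinalType.

(** Goedel's canonical well-ordering of pairs; comparing maxima first keeps the predecessors of a
    pair inside a square of bounded side. *)
Definition goedel (p q : W * W) :=
  let m := Order.max p.1 p.2 in let n := Order.max q.1 q.2 in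
  [\/ m < n, m = n /\ p.1 < q.1 | [/\ m = n, p.1 = q.1 & p.2 < q.2]].

Lemma goedel_wf : well_founded goedel.
Proof.
suff H m : forall a b, Order.max a b = m -> Acc goedel (a, b).
  by move=> [a b]; exact: (H _ a b erefl).
elim/(well_founded_ind (@ord_wf W)): m => m IHm a.
elim/(well_founded_ind (@ord_wf W)): a => a IHa b.
elim/(well_founded_ind (@ord_wf W)): b => b IHb e.
constructor => -[a' b'] [] /=; rewrite e.
- by move=> h; exact: (IHm _ h).
- by move=> [h1 h2]; exact: IHa.
- by move=> [h1 h2 h3]; rewrite h2 in h1 *; exact: IHb.
Qed.

Lemma goedel_total p q : [\/ goedel p q, p = q | goedel q p].
Proof.
case: p q => [a b] [a' b']; rewrite /goedel /=.
case: (ltgtP (Order.max a b) (Order.max a' b')) => h.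
- by constructor 1; constructor 1.
- by constructor 3; constructor 1.
- case: (ltgtP a a') => h1.
  + by constructor 1; constructor 2.
  + by constructor 3; constructor 2.
  + case: (ltgtP b b') => h2.
    * by constructor 1; constructor 3.
    * by constructor 3; constructor 3.
    * by constructor 2; rewrite h1 h2.
Qed.

(** The third hypothesis is the induction hypothesis. By [greedy_injects] it is enough to bound the
    predecessors of a pair: they fit into an infinite proper segment, by induction and [hotel], or
    are finitely many. *)
Lemma square_step : injects nat W ->
  (forall z : W, ~ injects W (seg z)) ->
  (forall z : W, injects nat (seg z) -> injects (seg z * seg z) (seg z)) ->
  injects (W * W) W.
Proof.
move=> Winf Winit IH.
apply: (greedy_injects goedel_wf goedel_total) => -[a b] Wab.
(* The predecessors of (a, b) lie in the square of the proper segment up to m. *)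
pose m := Order.max a b.
have Wm : injects W ({x : W | x <= m} * {x : W | x <= m}).
  apply: injects_trans Wab _.
  have h (p : {q : W * W | goedel q (a, b)}) : (sval p).1 <= m /\ (sval p).2 <= m.
    suff : Order.max (sval p).1 (sval p).2 <= m by rewrite ge_max => /andP.
    by case: p => -[x y] [/= /ltW|[-> _]|[->]].
  exists (fun p => (exist (fun x => x <= m) _ (proj1 (h p)),
                    exist (fun x => x <= m) _ (proj2 (h p)))).
  move=> [[x y] xy] [[x' y'] xy'] /= [ex ey].
  by apply: eq_sig_hprop => //=; rewrite ex ey.
have cm : injects {x : W | x <= m} (option (seg m)).
  exists (fun x => insub (sval x)) => x y /=.
  case: insubP => [u _ ux|]; case: insubP => [v _ vy|] //=.
    by move=> [uv]; apply: eq_sig_hprop => //; rewrite -ux -vy uv.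
  by rewrite -!leNgt => h1 h2 _; apply: eq_sig_hprop => //; apply: le_anti;
    rewrite (le_trans (svalP x) h1) (le_trans (svalP y) h2).
case: (pselect (injects nat (seg m))) => [minf|mfin].
  apply: (Winit m); apply: injects_trans Wm _; apply: injects_trans (IH m minf).
  by apply: injects_prod; apply: injects_trans cm (hotel minf).
move: mfin; rewrite injects_nat_infinite => /contrapT mfin.
have /injects_nat_infinite := injects_trans Winf Wm; apply.
have ofin : finite_set [set: option (seg m)].
  have -> : [set: option (seg m)] = [set None] `|` Some @` setT.
    by apply/seteqP; split=> -[x|] // _; [right; exists x|left].
  by rewrite finite_setU; split; [exact: finite_set1|exact: finite_image].
have cfin : finite_set [set: {x : W | x <= m}].
  by apply: card_le_finite ofin; apply/card_leTT.
rewrite (_ : [set: _ * _] = setT `*` setT); first exact: finite_setX.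
by apply/seteqP; split.
Qed.

End Goedel.

Lemma seg_square (W : ordinalType) (z : W) :
  injects nat (seg z) -> injects (seg z * seg z) (seg z).
Proof.
elim/(well_founded_ind (@ord_wf W)): z => z IH zinf.
(* A segment that is not initial has the size of a shorter one, where induction applies; otherwise
   [square_step] applies to the segment itself. *)
case: (pselect (exists2 y, y < z & injects (seg z) (seg y))) => [[y yz zy]|ny].
  apply: injects_trans (injects_prod zy zy) _.
  apply: injects_trans (IH y yz (injects_trans zinf zy)) _.
  exact: (seg_injects_le (ltW yz)).
apply: (@square_step (seg_ord z)) => // y.
- move=> zy; apply: ny; exists (val y); first exact: (svalP y).
  exact: injects_trans zy (@seg_seg_injects _ _ y).
- move=> yinf; have yy := seg_seg_injects y.
  apply: injects_trans (injects_prod yy yy) _.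
  apply: injects_trans (seg_injects_seg y).
  by apply: IH; [exact: (svalP y)|exact: injects_trans yinf yy].
Qed.

Lemma seg_noninjects (K : cardinalType) (z : K) : ~ injects K (seg z).
Proof. by have [_ h] := cardinal_initial z; rewrite card_leT_injects in h. Qed.

Lemma card_square (K : cardinalType) : injects nat K -> injects (K * K) K.
Proof.
move=> Kinf; apply: square_step => // z; [exact: seg_noninjects|exact: seg_square].
Qed.

Lemma injects_seq T : injects nat T -> injects (T * T) T -> injects (seq T) T.
Proof.
move=> [c cI] [p pI].
pose code := foldr (fun x y => p (x, y)) (c 0%N).
(* The length is stored too, since [c 0] may also be the code of a nonempty list. *)
exists (fun s => p (c (size s), code s)) => s t /pI [/cI].
elim: s t => [|x s IH] [|y t] //= [st] /pI [-> e].
by rewrite (IH t).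
Qed.

(** * Comparability, small sets and cofinality *)

Lemma injects_total (K : ordinalType) X :
  (exists z : K, injects X (seg z)) \/ injects K X.
Proof.
case: (pselect (exists z : K, injects X (seg z))) => [|/forallNP nX]; first by left.
right; apply: (greedy_injects (@ord_wf K)) nX => x y.
by case: (ltgtP x y) => h; [constructor 1|constructor 3|constructor 2].
Qed.

Lemma seg_minimal (K : ordinalType) X : ~ injects K X ->
  exists z : K, [/\ injects X (seg z), injects (seg z) X
    & forall y : seg_ord z, ~ injects X (seg y)].
Proof.
case: (injects_total K X) => // /ord_min [z Xz zmin] _.
have nX (y : seg_ord z) : ~ injects X (seg y).
  move=> /injects_trans /(_ (@seg_seg_injects _ _ y)) /zmin.
  by rewrite leNgt (svalP y).
exists z; split=> //.
by case: (injects_total (seg_ord z) X) => // -[y /nX].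
Qed.

Lemma card_lt_cardinal (K : ordinalType) X : ~ injects K X ->
  exists t : cardinalType, injects t X /\ injects X t.
Proof.
move=> /seg_minimal [z [Xz zX nX]].
have init (y : seg_ord z) : [set x | x < y] #< [set: seg_ord z].
  split; first exact: card_leT.
  by rewrite card_leT_injects => /(injects_trans Xz) /nX.
by exists (CardinalType init).
Qed.

(** [cofinality] speaks of cardinals only, so a nonempty [X] is replaced by an equinumerous cardinal
    [t]. If [F] were unbounded, [F \o d] would be cofinal of length [t], so [k] would inject into
    [t] and hence into [X]. *)
Lemma cofinality_bounded (L : ordinalType) (k : cardinalType) X (F : X -> L) :
  cofinality L k -> ~ injects k X -> exists z, forall x, F x < z.
Proof.
move=> [[c cP] kmin] nkX.
have [x0|nX] := pselect (inhabited X); last first.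
  have [a|/forallNP nk] := pselect (exists a : k, True).
    by exists (c (sval (cid a))) => x; case: nX.
  by case: nkX; exists (fun a => False_rect _ (nk a I)) => a; case: (nk a I).
have [t [tX [e eI]]] := card_lt_cardinal nkX.
case: x0 => x0.
pose d a := if pselect (exists x, e x = a) is left h then sval (cid h) else x0.
have dK x : d (e x) = x.
  rewrite /d; case: pselect => [h|]; last by case; exists x.
  by apply: eI; exact: (svalP (cid h)).
apply: contrapT => nz; apply: nkX; apply: injects_trans tX.
apply/card_leTT; apply: kmin; exists (F \o d) => z; apply: contrapT => na.
apply: nz; exists z => x; rewrite ltNge; apply/negP => zx; apply: na.
by exists (e x); rewrite /= dK.
Qed.

Lemma injects_prod_lt (K : cardinalType) X Y : injects nat K ->
  ~ injects K X -> ~ injects K Y -> ~ injects K (X * Y).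
Proof.
move=> Kinf /seg_minimal [y [Xy _ _]] /seg_minimal [z [Yz _ _]].
pose m := Order.max y z.
have Xm : injects X (seg m).
  by apply: injects_trans Xy (seg_injects_le _); rewrite le_max lexx.
have Ym : injects Y (seg m).
  by apply: injects_trans Yz (seg_injects_le _); rewrite le_max lexx orbT.
move=> /injects_trans /(_ (injects_prod Xm Ym)) Km.
case: (pselect (injects nat (seg m))) => [/seg_square mm|].
  exact: (@seg_noninjects K m (injects_trans Km mm)).
rewrite injects_nat_infinite => /contrapT mfin.
have /injects_nat_infinite := injects_trans Kinf Km; apply.
rewrite (_ : [set: _ * _] = setT `*` setT); first exact: finite_setX.
by apply/seteqP; split.
Qed.

Local Open Scope classical_set_scope.

Lemma card_ltTP T U : ([set: T] #< [set: U]) <-> injects T U /\ ~ injects U T.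
Proof. by rewrite /card_lt !card_leTT. Qed.

(** * The algebra generated by a family of sets *)

Section FiniteSupport.
Variables (I : eqType) (T : Type) (G : I -> set T).

(** A semantic form of being a finite Boolean combination, which spares a syntax of terms. One
    implication suffices, the condition being symmetric in [b] and [b']. *)
Definition finsupp (X : set T) := exists s : seq I, forall b b',
  (forall i, i \in s -> G i b <-> G i b') -> X b -> X b'.

Lemma finsupp_gen i : finsupp (G i).
Proof. by exists [:: i] => b b' /(_ i (mem_head _ _)) [+ _]; apply. Qed.

Lemma finsuppC X : finsupp X -> finsupp (~` X).
Proof.
move=> [s sP]; exists s => b b' bb'; apply: contra_not.
by apply: sP => i si; apply: iff_sym; exact: bb'.
Qed.

Lemma finsuppI X Y : finsupp X -> finsupp Y -> finsupp (X `&` Y).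
Proof.
move=> [s sP] [t tP]; exists (s ++ t) => b b' bb' [Xb Yb].
by split; [apply: sP Xb|apply: tP Yb] => i si; apply: bb'; rewrite mem_cat si ?orbT.
Qed.

Lemma finsuppU X Y : finsupp X -> finsupp Y -> finsupp (X `|` Y).
Proof.
move=> XP YP; rewrite -[_ `|` _]setCK setCU.
by apply: finsuppC; apply: finsuppI; exact: finsuppC.
Qed.

Lemma finsuppD X Y : finsupp X -> finsupp Y -> finsupp (X `\` Y).
Proof. by move=> XP YP; rewrite setDE; apply: finsuppI => //; exact: finsuppC. Qed.

Lemma finsupp0 : finsupp set0. Proof. by exists [::]. Qed.
Lemma finsuppT : finsupp setT. Proof. by exists [::]. Qed.

(* The sets of finite support are exactly the finite Boolean combinations of
   the G i. *)
Definition genalg := {X : set T | `[< finsupp X >]}.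

HB.instance Definition _ := SubChoice.copy genalg {X : set T | `[< finsupp X >]}.

Definition GenAlg X (XP : finsupp X) : genalg := exist _ X (asboolT XP).

Lemma genalgP (a : genalg) : finsupp (val a). Proof. exact/asboolP/(valP a). Qed.

Let le (a b : genalg) := `[< val a `<=` val b >].
Let lt (a b : genalg) := `[< val a `<` val b >].
Let meet a b := GenAlg (finsuppI (genalgP a) (genalgP b)).
Let join a b := GenAlg (finsuppU (genalgP a) (genalgP b)).
Let diff a b := GenAlg (finsuppD (genalgP a) (genalgP b)).
Let compl a := GenAlg (finsuppC (genalgP a)).

Let le_def a b : le a b = (meet a b == a).
Proof. by rewrite -val_eqE /=; apply/asboolP/eqP; rewrite setIidPl. Qed.

Let lt_def a b : lt a b = (b != a) && le a b.
Proof.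
rewrite -val_eqE; apply/idP/idP => [/asboolP|/andP[BA /asboolP AB]].
  by rewrite properEneq eq_sym => -[-> /asboolP].
by apply/asboolP; rewrite properEneq eq_sym.
Qed.

Let meetC : commutative meet. Proof. by move=> a b; apply: val_inj; exact: setIC. Qed.
Let joinC : commutative join. Proof. by move=> a b; apply: val_inj; exact: setUC. Qed.
Let meetA : associative meet. Proof. by move=> a b d; apply: val_inj; exact: setIA. Qed.
Let joinA : associative join. Proof. by move=> a b d; apply: val_inj; exact: setUA. Qed.
Let joinKI b a : meet a (join a b) = a.
Proof. by apply: val_inj; rewrite /= setUC setKU. Qed.
Let meetKU b a : join a (meet a b) = a.
Proof. by apply: val_inj; rewrite /= setIC setKI. Qed.
Let meetUl : left_distributive meet join.
Proof. by move=> a b d; apply: val_inj; exact: setIUl. Qed.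
Let meetxx : idempotent_op meet. Proof. by move=> a; apply: val_inj; exact: setIid. Qed.

HB.instance Definition _ := Order.isMeetJoinDistrLattice.Build set_display genalg
  le_def lt_def meetC joinC meetA joinA joinKI meetKU meetUl meetxx.

Let bot_le a : GenAlg finsupp0 <= a. Proof. by apply/asboolP; exact: sub0set. Qed.
Let le_top a : a <= GenAlg finsuppT. Proof. exact/asboolP. Qed.

HB.instance Definition _ := Order.hasBottom.Build set_display genalg bot_le.
HB.instance Definition _ := Order.hasTop.Build set_display genalg le_top.

Let diffKI a b : (b `&` diff a b)%O = \bot.
Proof. by apply: val_inj; rewrite /= setDE setICA setICr setI0. Qed.
Let joinIB a b : ((a `&` b) `|` diff a b)%O = a.
Proof. by apply: val_inj; rewrite /= setUC -setDDr setDv setD0. Qed.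
HB.instance Definition _ :=
  Order.BDistrLattice_hasSectionalComplement.Build set_display genalg diffKI joinIB.

Let complE a : compl a = ((\top : genalg) `\` a)%O.
Proof. by apply: val_inj; rewrite /= setTD. Qed.
HB.instance Definition _ :=
  Order.CBDistrLattice_hasComplement.Build set_display genalg complE.

Lemma genalg_leP (a b : genalg) : a <= b <-> val a `<=` val b.
Proof. by split=> [/asboolP|h]; last exact/asboolP. Qed.

(** A set is recovered from a support [s] together with the truth patterns on [s] that its points
    realise, so these finite data surject onto the algebra. *)
Lemma genalg_injects : injects genalg (seq I * seq (seq bool)).
Proof.
pose pat s b := [seq `[< G i b >] | i <- s].
have decP (p : seq I * seq (seq bool)) : finsupp [set b | pat p.1 b \in p.2].
  exists p.1 => b b' bb' /=; suff -> : pat p.1 b = pat p.1 b' by [].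
  by apply/eq_in_map => i ip; apply: asbool_equiv_eq; exact: bb'.
apply: (@injects_surj _ _ (fun p => GenAlg (decP p))) => X.
have [s sP] := genalgP X.
pose P := [seq tval p | p <-
  [seq p : (size s).-tuple bool <- enum {: (size s).-tuple bool} |
     `[< exists2 b, val X b & pat s b = p >]]].
exists (s, P); apply: val_inj; apply/seteqP; split=> b /=.
  move=> /mapP[p]; rewrite mem_filter => /andP[/asboolP[b' Xb' <-] _] ebb'.
  apply: sP Xb' => i si; move/eq_in_map: ebb' => /(_ i si) e.
  by split=> /asboolP h; apply/asboolP; rewrite ?e // -e.
move=> Xb; have sz : size (pat s b) == size s by rewrite size_map.
apply/mapP; exists (Tuple sz) => //.
by rewrite mem_filter mem_enum andbT; apply/asboolP; exists b.
Qed.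

(** The differences of [a] with members of the ideal generate a proper filter, and any ultrafilter
    extending it works. This turns ideal freeness into separation by ultrafilters on [T]. *)
Lemma ideal_genalg_ultra (S : set genalg) (a : genalg) :
  ~ ideal_generated S a ->
  exists U : set (set T), [/\ UltraFilter U, U (val a) & forall b, S b -> ~ U (val b)].
Proof.
have [K0 Kle KU] : is_ideal (ideal_generated S).
  split.
  - by move=> K [[]].
  - by move=> x y xy Ky K KS; case: (KS) => -[_ Kl _] _; exact: Kl xy (Ky K KS).
  - by move=> x y Kx Ky K KS; case: (KS) => -[_ _ KJ] _; apply: KJ; [exact: Kx|exact: Ky].
move=> nKa.
pose F := [set X | exists2 b, ideal_generated S b & val a `\` val b `<=` X].
have FF : ProperFilter F.
  split.
    move=> [b Kb ab]; apply: nKa; apply: Kle Kb; apply/genalg_leP => t ta.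
    by apply: contrapT => tb; case: (ab t).
  split.
  - by exists \bot.
  - move=> X Y [b Kb bX] [b' Kb' bY]; exists (b `|` b')%O; first exact: KU.
    by move=> x [ax /not_orP[bx b'x]]; split; [apply: bX|apply: bY].
  - by move=> X Y XY [b Kb bX]; exists b => // x /bX /XY.
have [U [UU FU]] := ultraFilterLemma FF.
exists U; split=> //.
  by apply: FU; exists \bot => // x [].
move=> b Sb Ub.
have : U (val a `\` val b) by apply: FU; exists b => //; exact: sub_gen_smallest.
move=> /(filterI Ub) /filter_ex [x [bx [_ nbx]]]; exact: nbx.
Qed.

End FiniteSupport.

Lemma sub_ideal_generated d (L : bDistrLatticeType d) (X Y : set L) :
  X `<=` Y -> ideal_generated X `<=` ideal_generated Y.
Proof. by move=> XY z Xz K [KI YK]; apply: Xz; split=> // y /XY /YK. Qed.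

Lemma sub_ideal_free d (B : ctbDistrLatticeType d) T (R R' : T -> T -> Prop)
    (a : T -> B) :
  (forall x y, R x y -> R' x y) -> ideal_free R' a -> ideal_free R a.
Proof.
move=> RR' aP x; have [a0 na] := aP x; split=> //.
apply: contra_not na; apply: sub_ideal_generated => _ [y Ry <-].
by exists y => //; exact: RR'.
Qed.

Lemma ideal_free_inj d (B : ctbDistrLatticeType d) S T (e : S -> T) (a : T -> B) :
  injective e -> ideal_free (fun y x => y <> x) a ->
  ideal_free (fun y x => y <> x) (a \o e).
Proof.
move=> eI aP x; have [a0 na] := aP (e x); split=> //.
apply: contra_not na; apply: sub_ideal_generated => _ [y yx <-]; exists (e y) => //=.
by move=> /eI.
Qed.

(** * The construction *)

Section Construction.
Variables (mu lambda cflambda : cardinalType) (delta : ordinalType).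
Variables (lam : delta -> cardinalType) (J : set (set delta)) (A : set delta).
Variables (g : cflambda -> prod_on lam A) (h : lambda -> prod_on lam (~` A)).
Hypothesis cf_lambda : cofinality lambda cflambda.
Hypothesis mu_lt_cf : [set: mu] #< [set: cflambda].
Hypothesis cf_lt_lambda : [set: cflambda] #< [set: lambda].
Hypothesis lam_increasing : forall i j, i < j -> [set: lam i] #< [set: lam j].
Hypothesis lam_regular : forall i, regular_cardinal (lam i).
Hypothesis lam_limit : sup_cardinal (fun k => exists i, k = lam i) mu.
Hypothesis J_ideal : is_ideal J.
Hypothesis J_bounded :
  forall X : set delta, (exists j, forall i, X i -> i < j) -> J X.
Hypothesis A_notin_J : ~ J A.
Hypothesis AC_notin_J : ~ J (~` A)%classic.
Hypothesis g_increasing : forall a b, a < b -> lt_mod J (g a) (g b).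
Hypothesis g_cofinal : forall f : prod_on lam A, exists a, lt_mod J f (g a).
Hypothesis h_distinct : injective h.
Hypothesis few_restrictions : forall j : delta,
  range (fun a => restr (h a) j) `|` range (fun b => restr (g b) j)
    #< [set: lam j].

Lemma delta_inhabited : exists i : delta, True.
Proof.
apply: contrapT => /forallNP nd; apply: A_notin_J.
have -> : A = \bot by apply/seteqP; split=> i; case: (nd i).
by case: J_ideal.
Qed.

(** If [i] were last, whichever of [A] and its complement misses [i] would be bounded and so in
    [J]. *)
Lemma delta_succ (i : delta) : exists j, i < j.
Proof.
apply: contrapT => /forallNP imax.
have ile k : k <= i by rewrite leNgt; apply/negP.
have [Ai|nAi] := pselect (A i).
- apply: AC_notin_J; apply: J_bounded; exists i => k nAk.
  by rewrite lt_neqAle ile andbT; apply/eqP => ki; apply: nAk; rewrite ki.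
- apply: A_notin_J; apply: J_bounded; exists i => k Ak.
  by rewrite lt_neqAle ile andbT; apply/eqP => ki; apply: nAi; rewrite -ki.
Qed.

Lemma lam_mu i : injects (lam i) mu.
Proof. by apply/card_leTT; case: lam_limit => + _; apply; exists i. Qed.

Lemma lam_infinite i : injects nat (lam i).
Proof. by apply/card_leTT; case: (lam_regular i). Qed.

Lemma mu_infinite : injects nat mu.
Proof.
by have [i _] := delta_inhabited; exact: injects_trans (lam_infinite i) (lam_mu i).
Qed.

Lemma mu_cf : injects mu cflambda. Proof. by case/card_ltTP: mu_lt_cf. Qed.
Lemma cf_mu : ~ injects cflambda mu. Proof. by case/card_ltTP: mu_lt_cf. Qed.
Lemma cf_lam : injects cflambda lambda. Proof. by case/card_ltTP: cf_lt_lambda. Qed.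
Lemma lam_cf : ~ injects lambda cflambda. Proof. by case/card_ltTP: cf_lt_lambda. Qed.

Lemma cf_infinite : injects nat cflambda.
Proof. exact: injects_trans mu_infinite mu_cf. Qed.

Lemma lambda_infinite : injects nat lambda.
Proof. exact: injects_trans cf_infinite cf_lam. Qed.

Lemma mu_square : injects (mu * mu) mu.
Proof. exact: card_square mu_infinite. Qed.

Lemma delta_mu : injects delta mu.
Proof.
have lamN i : ~ injects mu (lam i).
  have [j /lam_increasing /card_ltTP [_ ij]] := delta_succ i.
  by move=> /(injects_trans (lam_mu j)).
(* lam i is equinumerous to the segment below y i, so y is injective. *)
pose y i := sval (cid (seg_minimal (lamN i))).
have yP i : injects (lam i) (seg (y i)) /\ injects (seg (y i)) (lam i).
  by have [? ? _] := svalP (cid (seg_minimal (lamN i))).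
suff yN i j : i < j -> y i <> y j.
  by exists y => i j; case: (ltgtP i j) => // [/yN|/yN /nesym].
move=> /lam_increasing /card_ltTP [_ ij] yij; apply: ij.
by apply: injects_trans (proj1 (yP j)) _; rewrite -yij; exact: (proj2 (yP i)).
Qed.

Lemma small_cf P : injects P mu -> ~ injects cflambda P.
Proof. by move=> Pmu /injects_trans /(_ Pmu) /cf_mu. Qed.

Lemma injects_mu_prod X Y : injects X mu -> injects Y mu -> injects (X * Y) mu.
Proof. by move=> XM YM; apply: injects_trans (injects_prod XM YM) mu_square. Qed.

Lemma injects_mu_seq X : injects X mu -> injects (seq X) mu.
Proof.
move=> [e eI]; apply: injects_trans (injects_seq mu_infinite mu_square).
by exists (map e); exact: inj_map.
Qed.

Lemma injects_mu_count (X : countType) : injects X mu.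
Proof.
by apply: injects_trans mu_infinite; exists pickle; exact: pcan_inj pickleK.
Qed.

(** * Blocks, the functions [f] and the generators *)

Lemma block_ex : exists c : cflambda -> lambda, forall x, exists a, x <= c a.
Proof. by case: cf_lambda. Qed.

Let c := sval (cid block_ex).

Let cP x : exists a, x <= c a.
Proof. exact: (svalP (cid block_ex)). Qed.

(** The chosen [c] is cofinal but need not be monotone, so the least suitable index is taken. The
    fibre over [z] is bounded by [c z]. *)
Definition block (a : lambda) : cflambda := s2val (cid2 (ord_min (cP a))).

Lemma le_block a : a <= c (block a).
Proof. by rewrite /block; case: cid2. Qed.

Lemma block_min (a : lambda) z : (forall y, y < z -> c y < a) -> z <= block a.
Proof.
rewrite /block; case: cid2 => /= b ab _ zP.
by rewrite leNgt; apply/negP => /zP; rewrite ltNge ab.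
Qed.

Definition f (a : lambda) (i : delta) : lam i :=
  match pselect (i \in A) with
  | left iA => g (block a) (exist _ i iA)
  | right iA => h a (exist _ i (mem_set (fun Ai => iA (mem_set Ai))))
  end.

Lemma f_in a (i : A) : f a (val i) = g (block a) i.
Proof.
rewrite /f; case: i => i iA /=; case: pselect => // iA'.
by rewrite (Prop_irrelevance iA iA').
Qed.

Lemma f_out a (i : (~` A)%classic) : f a (val i) = h a i.
Proof.
rewrite /f; case: i => i iA /=; case: pselect => [iA'|iA'].
  by case: (set_mem iA (set_mem iA')).
by rewrite (Prop_irrelevance (mem_set _) iA).
Qed.

Lemma f_inj a b : (forall i, f a i = f b i) -> a = b.
Proof.
move=> fab; apply: h_distinct; apply: functional_extensionality_dep => i.
by rewrite -!f_out.
Qed.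

Definition agree (i : delta) (a b : lambda) := forall k, k < i -> f a k = f b k.

Lemma agree_sym i a b : agree i a b -> agree i b a.
Proof. by move=> ab k /ab. Qed.

Lemma first_diff a b : a <> b -> exists2 i, f a i <> f b i & agree i a b.
Proof.
move=> ab; have [|i fi imin] := @ord_min delta (fun i => f a i <> f b i).
  by apply: contrapT => /forallNP nd; apply/ab/f_inj => i; exact: contrapT (nd i).
exists i => // k ki; apply: contrapT => /imin.
by rewrite leNgt ki.
Qed.

Definition gen (a : lambda) : set lambda :=
  [set b | b = a \/ exists i, [/\ A i, f a i < f b i & agree i a b]].

Lemma gen_anti a b : gen a b -> gen b a -> a = b.
Proof.
move=> [//|[i [_ fi ai]]] [//|[j [_ fj aj]]].
case: (ltgtP i j) => [ij|ji|ij].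
- by have := aj _ ij => e; rewrite e ltxx in fi.
- by have := ai _ ji => e; rewrite e ltxx in fj.
- by move: fj; rewrite -ij ltNge (ltW fi).
Qed.

Lemma f_block a b i : block a = block b -> A i -> f a i = f b i.
Proof.
by rewrite /f => -> Ai; case: pselect => // nAi; case: (nAi (mem_set Ai)).
Qed.

Lemma gen_block a b : block a = block b -> gen a b -> a = b.
Proof. by move=> ab [//|[i [Ai]]]; rewrite (f_block ab Ai) ltxx. Qed.

(** When [b] is outside the cone of the restriction of [f a] to [i], the first difference of [f a]
    and [f b] lies below [i], where [f a'] equals [f a]. *)
Lemma gen_agreel i a a' b : agree i a a' -> ~ agree i a b -> gen a b -> gen a' b.
Proof.
move=> aa' nab [ba|[j [Aj fj ab]]]; first by case: nab; rewrite ba.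
have ji : j < i.
  rewrite ltNge; apply/negP => ij; apply: nab => k ki.
  by apply: ab; exact: lt_le_trans ij.
right; exists j; split; rewrite -?aa' // => k kj.
by rewrite -aa' ?ab // (lt_trans kj ji).
Qed.

Lemma gen_agreer i a b b' : agree i b b' -> ~ agree i a b -> gen a b <-> gen a b'.
Proof.
have H b1 b2 : agree i b1 b2 -> ~ agree i a b1 -> gen a b1 -> gen a b2.
  move=> bb' nab [ba|[j [Aj fj ab]]]; first by case: nab; rewrite ba.
  have ji : j < i.
    rewrite ltNge; apply/negP => ij; apply: nab => k ki.
    by apply: ab; exact: lt_le_trans ij.
  right; exists j; split; rewrite -?bb' // => k kj.
  by rewrite -bb' ?ab // (lt_trans kj ji).
move=> bb' nab; split; first exact: H bb' nab.
apply: H; first exact: agree_sym.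
by move=> ab'; apply: nab => k ki; rewrite ab' // bb'.
Qed.

(** Were every block of size at most [k], the pairs of a block and a position in it would inject
    [lambda] into the product of two smaller cardinals. *)
Lemma large_block (k : cardinalType) : ~ injects lambda k ->
  exists z, ~ injects {a | block a = z} k.
Proof.
move=> lk; apply: contrapT => /forallNP nz.
have {}nz z : injects {a | block a = z} k by exact: contrapT (nz z).
apply: (injects_prod_lt lambda_infinite lam_cf lk).
pose e z := sval (cid (nz z)).
have eE a z (az : block a = z) : e (block a) (exist _ a erefl) = e z (exist _ a az).
  by case: z / az.
exists (fun a => (block a, e (block a) (exist _ a erefl))) => a b [ab].
by rewrite (eE a _ ab) => /(svalP (cid (nz (block b)))) [].
Qed.

(** * Coding initial segments of the functions *)

Definition node (j : delta) :=
  {t | (range (fun a => restr (h a) j) `|` range (fun b => restr (g b) j)) t}.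

Lemma node_small j : ~ injects (lam j) (node j).
Proof. by have [_] := few_restrictions j; rewrite card_leT_injects. Qed.

Definition hnode j a : node j :=
  exist _ (restr (h a) j) (or_introl (ex_intro2 _ _ a I erefl)).
Definition gnode j b : node j :=
  exist _ (restr (g b) j) (or_intror (ex_intro2 _ _ b I erefl)).
(** The hypothesis counts restrictions of the [h]'s and of the [g]'s, not of their unions, so the
    restriction of [f a] to [j] is encoded by a pair of nodes. *)
Definition tnode j a := (hnode j a, gnode j (block a)).

Lemma tnode_small j : ~ injects (lam j) (node j * node j).
Proof. exact: injects_prod_lt (lam_infinite j) (@node_small j) (@node_small j). Qed.

Lemma tnode_agree j a b : tnode j a = tnode j b -> agree j a b.
Proof.
move=> [eh eg] k kj.
move/(congr1 (fun t => t k)): eh; move/(congr1 (fun t => t k)): eg.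
rewrite /restr kj /f; case: pselect => [kA|kA]; case: pselect => [kA'|kA'].
- by case: (set_mem kA' (set_mem kA)).
- by move=> [].
- by move=> _ [e]; rewrite (Prop_irrelevance (mem_set _) kA').
- by case: kA'; apply/mem_set => /mem_set.
Qed.

Lemma tnode_code_ex j : injects (node j * node j) mu.
Proof.
apply: injects_trans (lam_mu j).
case: (injects_total (lam j) (node j * node j)) => [[z /injects_trans]|/tnode_small//].
by apply; exact: seg_injects.
Qed.

(** Codes for all levels [j] live in the one set [mu], so that finite labels built from them are
    fewer than [cflambda]. *)
Definition code j a : mu := sval (cid (tnode_code_ex j)) (tnode j a).

Lemma code_agree j a b : code j a = code j b -> agree j a b.
Proof. by move=> /(svalP (cid (tnode_code_ex j))) /tnode_agree. Qed.

Definition vcode j (v : lam j) : mu := sval (cid (lam_mu j)) v.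

Lemma vcode_inj j : injective (@vcode j).
Proof. exact: (svalP (cid (lam_mu j))). Qed.


(** * Recurring labels and zigzags *)

(** If every label failed, its values would be bounded past some index, and all these bounds would
    lie below a common [m], as the labels are fewer than [cflambda]. Then each [n] is below [m] or
    [a n] is, so [n] is recovered from this alternative, its label and an element of [seg m]: too
    few data for [lambda]. *)
Lemma big_label P (lab : lambda -> P) (a : lambda -> lambda) :
  ~ injects cflambda P -> injective (fun n => (lab n, a n)) ->
  exists p, forall y z, exists n, [/\ lab n = p, y < n & z < a n].
Proof.
move=> cfP labI; apply: contrapT => /forallNP nbig.
have {nbig} bnd p : exists b : lambda * lambda,
    forall n, lab n = p -> b.1 < n -> a n <= b.2.
  apply: contrapT => /forallNP nb; apply: (nbig p) => y z.
  apply: contrapT => /forallNP nn; apply: (nb (y, z)) => n /= ln yn.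
  by rewrite leNgt; apply/negP => za; case: (nn n).
have [y yP] := cofinality_bounded (fun p => (sval (cid (bnd p))).1) cf_lambda cfP.
have [z zP] := cofinality_bounded (fun p => (sval (cid (bnd p))).2) cf_lambda cfP.
pose m := Order.max y z.
have mP n : (n < m) || (a n < m).
  rewrite !lt_max; case: (ltP n y) => //= yn; apply/orP; right; apply/orP; right.
  apply: le_lt_trans (zP (lab n)).
  exact: (svalP (cid (bnd (lab n))) n erefl (lt_le_trans (yP (lab n)) yn)).
have lamP : ~ injects lambda P by move=> lP; apply: cfP; exact: injects_trans cf_lam lP.
have lamB : ~ injects lambda bool.
  by move=> /injects_trans /(_ (injects_mu_count bool)) /(injects_trans cf_lam) /cf_mu.
apply: (injects_prod_lt lambda_infinite lamB
  (injects_prod_lt lambda_infinite lamP (@seg_noninjects lambda m))).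
have pick n : exists q : bool * seg m, val q.2 = if q.1 then n else a n.
  case/orP: (mP n) => nm; first by exists (true, exist _ n nm).
  by exists (false, exist _ (a n) nm).
pose q n := sval (cid (pick n)).
have qP n : val (q n).2 = if (q n).1 then n else a n := svalP (cid (pick n)).
exists (fun n => ((q n).1, (lab n, (q n).2))) => n n' [e1 e2 e3].
have := qP n; rewrite e3 qP e1; case: (q n').1 => // e4.
by apply: labI; rewrite e2 e4.
Qed.

Lemma J_sub X Y : X `<=` Y -> J Y -> J X.
Proof. by case: J_ideal => _ Jd _ /subsetPset; exact: Jd. Qed.

Lemma zigzag (S : set lambda) (a : lambda -> lambda) :
  (forall y z, exists n, [/\ S n, y < n & z < a n]) ->
  exists i n1 n2 n3,
    [/\ [/\ S n1, S n2 & S n3], n1 < n2, n2 < n3, A i &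
      [/\ agree i (a n1) (a n2), agree i (a n2) (a n3),
          f (a n1) i < f (a n2) i & f (a n3) i < f (a n2) i]].
Proof.
move=> Sbig.
(* Beyond some y, every value (i, f | i, f i) that occurs in S does so again
   arbitrarily late. *)
pose sig n i := (i, code i (a n), vcode (f (a n) i)).
have [e _] := lambda_infinite.
have bnd q : exists y,
    (forall z, exists n, [/\ S n, z < n & exists i, sig n i = q]) \/
    (forall n, S n -> y < n -> forall i, sig n i <> q).
  have [|] := pselect (forall z, exists n, [/\ S n, z < n & exists i, sig n i = q]).
    by exists (e 0%N); left.
  move/existsNP => [z /forallNP zP]; exists z; right => n Sn zn i si.
  by apply: (zP n); split=> //; exists i.
have cfsig : ~ injects cflambda (delta * mu * mu)%type.
  apply: small_cf; apply: injects_mu_prod (injects_refl _).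
  exact: injects_mu_prod delta_mu (injects_refl _).
have [y yP] := cofinality_bounded (fun q => sval (cid (bnd q))) cf_lambda cfsig.
have persist n i z : S n -> y < n -> exists m,
    [/\ S m, z < m, agree i (a n) (a m) & f (a m) i = f (a n) i].
  move=> Sn yn; have := yP (sig n i).
  case: (cid (bnd (sig n i))) => /= b [hz|nsig] by_.
    have [m [Sm zm [k [ki ec ev]]]] := hz z; subst k; exists m; split=> //.
      exact/agree_sym/code_agree.
    exact: vcode_inj ev.
  by case: (nsig n Sn (lt_trans by_ yn) i).
suff [i [n [n' [Ai [Sn yn] [Sn' yn'] nn' fnn']]]] : exists i n n',
    [/\ A i, S n /\ y < n, S n' /\ y < n', agree i (a n) (a n') & f (a n) i < f (a n') i].
  (* The higher value recurs after [n], and then the lower one recurs after that: an ascent followed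
     by a descent. *)
  have [n2 [S2 n12 a2 f2]] := persist n' i n Sn' yn'.
  have [n3 [S3 n23 a3 f3]] := persist n i n2 Sn yn.
  exists i, n, n2, n3; split=> //; split; rewrite ?f2 ?f3 // => k ki.
    by rewrite nn' ?a2.
  by rewrite -a2 // -nn' // a3.
apply: contrapT => flat.
have {}flat i n n' : A i -> S n -> y < n -> S n' -> y < n' ->
    agree i (a n) (a n') -> f (a n) i = f (a n') i.
  move=> Ai Sn yn Sn' yn' nn'.
  case: (ltgtP (f (a n) i) (f (a n') i)) => // fnn'; case: flat.
    by exists i, n, n'.
  by exists i, n', n; split=> //; exact: agree_sym.
(* If no two f's split at a level in A, then there are fewer than lam i values
   at level i, bounded by regularity, against the cofinality of the g's. *)
have bound i : A i -> exists v : lam i, forall n, S n -> y < n -> f (a n) i < v.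
  move=> Ai; have [d _] := lam_infinite i.
  pose F t := if pselect (exists n, [/\ S n, y < n & tnode i (a n) = t]) is left p
    then f (a (sval (cid p))) i else d 0%N.
  have [v vP] := cofinality_bounded F (proj2 (lam_regular i)) (@tnode_small i).
  exists v => n Sn yn; have := vP (tnode i (a n)); rewrite /F.
  case: pselect => [p|[]]; last by exists n.
  case: (cid p) => /= m [Sm ym tm].
  by rewrite (flat i m n) //; exact: tnode_agree.
pose gam : prod_on lam A := fun i => sval (cid (bound (val i) (set_mem (valP i)))).
have [z zP] := g_cofinal gam.
(* An index above [w] lies beyond [c b] for all [b < z], so its block is at least [z], where the
   [g]'s exceed [gam] modulo [J]. *)
have [w wP] := cofinality_bounded (fun b : seg z => c (val b)) cf_lambda
  (@seg_noninjects _ z).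
have [n [Sn yn wn]] := Sbig y w.
have zn : z <= block (a n).
  by apply: block_min => b bz; exact: lt_trans (wP (exist _ b bz)) wn.
have gamP (i : A) : g (block (a n)) i < gam i.
  rewrite -f_in; exact: (svalP (cid (bound (val i) (set_mem (valP i)))) n Sn yn).
apply: A_notin_J.
move: zn; rewrite le_eqVlt => /orP[/eqP zn|/g_increasing zn].
  apply: J_sub zP => i Ai; exists (exist _ i (mem_set Ai)) => //=.
  by rewrite zn; exact: (ltW (gamP (exist _ i (mem_set Ai)))).
(* Every point of [A] falls into one of two exceptional sets in [J]: for [gam] against [g z], or for
   [g z] against the later function. *)
have [_ _ /(_ _ _ zP zn)] := J_ideal.
apply: J_sub => i Ai; pose i' : A := exist _ i (mem_set Ai).
case: (leP (g z i') (gam i')) => h1; [left|right]; exists i' => //=.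
exact/ltW/(lt_trans (gamP i')).
Qed.

Lemma gen_up i a b : A i -> agree i a b -> f a i < f b i -> gen a b.
Proof. by move=> Ai ab fi; right; exists i. Qed.

Lemma gen_down i a b : A i -> agree i a b -> f b i < f a i -> ~ gen a b.
Proof.
move=> Ai ab fi gab; have gba := gen_up Ai (agree_sym ab) fi.
by move: fi; rewrite (gen_anti gab gba) ltxx.
Qed.

(** * Literals and their truncations *)

Definition lit (a : lambda) (e : bool) : set lambda :=
  if e then gen a else ~` gen a.

(** Quantifying over [a] makes the set depend on a code in [mu] instead of an index in [lambda], so
    at most [mu] many such sets occur. *)
Definition trunc_lit (l : delta * mu * bool) : set lambda :=
  [set b | exists a, [/\ code l.1.1 a = l.1.2, lit a l.2 b & ~ agree l.1.1 a b]].

Lemma lit_agreel i a a' e b : agree i a a' -> ~ agree i a b -> lit a e b -> lit a' e b.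
Proof.
case: e => /= aa' nab; first exact: gen_agreel aa' nab.
apply: contra_not; apply: (@gen_agreel i); first exact: agree_sym.
by move=> ab; apply: nab => k ki; rewrite aa' ?ab.
Qed.

Lemma lit_agreer i a b b' e : agree i b b' -> ~ agree i a b -> lit a e b -> lit a e b'.
Proof.
move=> bb' nab; have H := gen_agreer bb' nab.
by case: e => /=; [|apply: contra_not]; apply H.
Qed.

(* Outside the cone of f_a | i, lit a e depends on f_a | i only. *)
Lemma trunc_litE i a e b :
  trunc_lit (i, code i a, e) b <-> lit a e b /\ ~ agree i a b.
Proof.
split=> [[a' [/= /code_agree aa' ab nab]]|[ab nab]]; last by exists a.
split; first exact: lit_agreel aa' nab ab.
by move=> ab'; apply: nab => k ki; rewrite aa' ?ab'.
Qed.

(** * Ultrafilters on the index set *)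

Section Ultrafilters.
Variables (U : set (set lambda)) (UU : UltraFilter U).

Let UI X Y : U X -> U Y -> U (X `&` Y). Proof. exact: filterI. Qed.
Let US X Y : X `<=` Y -> U X -> U Y. Proof. exact: filterS. Qed.
Let U0 : ~ U set0. Proof. exact: filter_not_empty. Qed.

(** In the tree of initial segments, the ultrafilter converges to the branch [f a]. *)
Definition branch (a : lambda) := forall i, U [set b | agree i a b].

Lemma ultra_lit a : exists e, U (lit a e).
Proof. by case: (in_ultra_setVsetC (gen a) UU) => ?; [exists true|exists false]. Qed.

Lemma branch_or_trunc a :
  branch a \/ exists l e, U (trunc_lit l) /\ trunc_lit l `<=` lit a e.
Proof.
have [|/existsNP[i ni]] := pselect (branch a); first by left.
right; have [e Ue] := ultra_lit a.
exists (i, code i a, e), e; split; last by move=> b /trunc_litE [].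
case: (in_ultra_setVsetC [set b | agree i a b] UU) => // /(UI Ue).
by apply: US => b [? ?]; apply/trunc_litE.
Qed.

Lemma branch_uniq a a' : branch a -> branch a' -> a = a'.
Proof.
move=> ba ba'; apply: contrapT => /first_diff [i fi _].
(* [agree j] compares levels strictly below [j], so a [j] beyond [i] is needed to make the two cones
   disjoint. *)
have [j ij] := delta_succ i; have := UI (ba j) (ba' j).
rewrite (_ : _ `&` _ = set0) //; apply/seteqP; split=> // b [/(_ _ ij) e /(_ _ ij) e'].
by apply: fi; rewrite e e'.
Qed.

(** A cone of [f a'] past its first difference from [f a] lies on the same side of [gen a] as [a']
    does. *)
Lemma branch_lit a a' e : a <> a' -> branch a' -> lit a e a' -> U (lit a e).
Proof.
move=> /first_diff [i fi _] ba' aa'; have [j ij] := delta_succ i.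
apply: US (ba' j) => b a'b; apply: lit_agreer a'b _ aa'.
by move=> /(_ _ ij).
Qed.

Definition trunc_lits (ls : seq (delta * mu * bool)) : set lambda :=
  [set b | forall l, l \in ls -> trunc_lit l b].

Lemma trunc_lits_support (s : seq lambda) : exists2 ls, U (trunc_lits ls) &
  forall a, a \in s -> branch a \/ exists e, trunc_lits ls `<=` lit a e.
Proof.
elim: s => [|a s [ls Uls lsP]].
  by exists [::] => //; apply: US (filterT : U setT).
case: (branch_or_trunc a) => [ba|[l [e [Ul le]]]].
  by exists ls => // a'; rewrite inE => /orP[/eqP ->|/lsP//]; left.
exists (l :: ls).
  apply: US (UI Ul Uls) => b [bl bls] l'.
  by rewrite inE => /orP[/eqP ->//|/bls].
move=> a'; rewrite inE => /orP[/eqP ->|/lsP[|[e' le']]]; first 1 last.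
- by left.
- right; exists e' => b bl; apply: le' => l' l'ls; apply: bl.
  by rewrite inE l'ls orbT.
- by right; exists e => b bl; apply: le; apply: bl; rewrite inE eqxx.
Qed.

(** All generators in the support are decided by truncated literals, except at most one, by
    [branch_uniq], which keeps its own index [a]. When [k] is [None], the index [a] is arbitrary. *)
Lemma finsupp_label X : finsupp gen X -> U X -> exists ls k a,
  U (trunc_lits ls) /\
  match k with
  | Some e => [/\ branch a, U (lit a e) & trunc_lits ls `&` lit a e `<=` X]
  | None => trunc_lits ls `<=` X
  end.
Proof.
move=> [s sP] UX; have [ls Uls lsP] := trunc_lits_support s.
have litE a e b b' : lit a e b -> lit a e b' -> gen a b <-> gen a b'.
  by case: e.
have [[a [sa ba]]|/forallNP nb] := pselect (exists a, a \in s /\ branch a).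
- have [e Ue] := ultra_lit a.
  exists ls, (Some e), a; split=> //; split=> // b [lb ab].
  have [b' [Xb' [lb' ab']]] := filter_ex (UI UX (UI Uls Ue)).
  apply: sP Xb' => a' sa'; case: (lsP _ sa') => [/(branch_uniq ba) <-|[e' le']].
    exact: litE ab' ab.
  by apply: litE; [exact: le' lb'|exact: le' lb].
- have [e _] := lambda_infinite.
  exists ls, None, (e 0%N); split=> // b lb.
  have [b' [Xb' lb']] := filter_ex (UI UX Uls).
  apply: sP Xb' => a' sa'; case: (lsP _ sa') => [ba|[e' le']].
    by case: (nb a').
  by apply: litE; [exact: le' lb'|exact: le' lb].
Qed.

End Ultrafilters.

(** Two indices with the same label, and the same branch index or none, would have each set in the
    other's ultrafilter. So [big_label] applies, and [zigzag] supplies a pair that contradicts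
    separation. *)
Lemma no_separated_ultra (R : lambda -> lambda -> Prop)
    (a : lambda -> set lambda) (U : lambda -> set (set lambda)) :
  (forall n m, n < m -> R n m) \/ (forall n m, n < m -> R m n) ->
  (forall n, finsupp gen (a n)) -> (forall n, UltraFilter (U n)) ->
  (forall n, U n (a n)) -> (forall n m, R n m -> ~ U m (a n)) -> False.
Proof.
move=> Rtot afin UU Ua Usep.
have /choice [ls /choice [k /choice [al H]]] :=
  fun n => finsupp_label (UU n) (afin n) (Ua n).
have same n m : n <> m -> ls n = ls m -> k n = k m ->
    (k n = None \/ al n = al m) -> False.
  have half n' m' : ls n' = ls m' -> k n' = k m' ->
      (k n' = None \/ al n' = al m') -> U m' (a n').
    move=> els ek ekal; have [_] := H n'; have [Ul] := H m'.
    rewrite els -ek; case: (k n') ekal => [e [//|<-] [_ Ue _] [_ _ sub]|_ _ sub].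
      exact: filterS sub (filterI Ul Ue).
    exact: filterS sub Ul.
  move=> nm els ek ekal.
  have Unm := half _ _ els ek ekal.
  have Umn : U n (a m).
    by apply: half => //; case: ekal => [|->]; [rewrite ek; left|right].
  by case: (ltgtP n m) => // lt; case: Rtot => /(_ _ _ lt) /Usep; apply.
have cfP : ~ injects cflambda (seq (delta * mu * bool) * option bool)%type.
  apply: small_cf; apply: injects_mu_prod (injects_mu_count _).
  apply: injects_mu_seq; apply: injects_mu_prod (injects_mu_count _).
  exact: injects_mu_prod delta_mu (injects_refl _).
have [|[l o] big] := @big_label _ (fun n => (ls n, k n)) al cfP.
  move=> n m [el ek ea]; apply: contrapT => nm.
  by apply: (same n m) => //; right.
have [e0 _] := lambda_infinite; move: (e0 0%N) => z.
case: o big => [e|] big; last first.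
  have [n [[eln ekn] _ _]] := big z z.
  have [m [[elm ekm] nm _]] := big n z.
  apply: (same n m); rewrite ?eln ?elm ?ekn ?ekm //; last by left.
  by move=> e; rewrite e ltxx in nm.
(* [U m] follows the branch of [al m], so if [al m] lies in the literal of [al n], this literal and
   the shared truncated ones put [a n] into [U m]. *)
have sep n m : (ls n, k n) = (l, Some e) -> (ls m, k m) = (l, Some e) ->
    R n m -> al n <> al m -> ~ lit (al n) e (al m).
  move=> [eln ekn] [elm ekm] /Usep nU aa am.
  have [_] := H n; have [Ulm] := H m.
  rewrite ekn ekm => -[bm _ _] [_ _ sub]; apply: nU.
  have Ul := branch_lit (UU m) aa bm am.
  rewrite elm -eln in Ulm; exact: filterS sub (filterI Ulm Ul).
have [i [n1 [n2 [n3 [[S1 S2 S3] n12 n23 Ai [a12 a23 f12 f32]]]]]] := zigzag big.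
have al12 : al n1 <> al n2 by move=> E; rewrite E ltxx in f12.
have al23 : al n2 <> al n3 by move=> E; rewrite E ltxx in f32.
have g12 := gen_up Ai a12 f12; have g21 := gen_down Ai (agree_sym a12) f12.
have g32 := gen_up Ai (agree_sym a23) f32; have g23 := gen_down Ai a23 f32.
(* Each combination of sign and direction of separation is refuted by one leg of the zigzag: the
   ascent from [n1] to [n2] or the descent from [n2] to [n3]. *)
case: e sep {H} S1 S2 S3 big => /= sep S1 S2 S3 _; case: Rtot => Rlt.
- exact: (sep n1 n2 S1 S2 (Rlt _ _ n12) al12 g12).
- exact: (sep n3 n2 S3 S2 (Rlt _ _ n23) (nesym al23) g32).
- exact: (sep n2 n3 S2 S3 (Rlt _ _ n23) al23 g23).
- exact: (sep n2 n1 S2 S1 (Rlt _ _ n12) (nesym al12) g21).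
Qed.

(** * Cardinal invariants of the algebra *)

Definition B := genalg gen.

Lemma B_card : [set: B] #= [set: lambda].
Proof.
apply/card_eqPle; split; apply/card_leTT.
- have ll := card_square lambda_infinite.
  apply: injects_trans (@genalg_injects _ _ gen) _; apply: (injects_trans _ ll).
  apply: injects_prod; first exact: injects_seq lambda_infinite ll.
  exact: injects_trans (injects_mu_count _) (injects_trans mu_cf cf_lam).
- exists (fun a => GenAlg (finsupp_gen gen a) : B) => a b /(congr1 val) /= ab.
  apply: gen_anti; first by rewrite ab; left.
  by rewrite -ab; left.
Qed.

Lemma block_s_seq (t : cardinalType) z :
  injects t {a | block a = z} -> has_s_seq B t.
Proof.
move=> [e eI]; exists (fun y => GenAlg (finsupp_gen gen (sval (e y)))) => y.
have gyy : gen (sval (e y)) (sval (e y)) by left.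
split; first by apply/eqP => /(congr1 val) /= g0; rewrite g0 in gyy.
(* The sets omitting the point [sval (e y)] form an ideal that contains the other generators of the
   sequence, by [gen_block], but not the one of [y]. *)
pose K := [set b : B | ~ val b (sval (e y))].
have KI : is_ideal K.
  split; first by [].
  - by move=> b b' /genalg_leP bb'; apply: contra_not; exact: bb'.
  - by move=> b b' Kb Kb' [].
move=> /(_ K); apply => //; split=> // _ [y' yy' <-] /= gy.
apply: yy'; apply: eI; apply: eq_sig_hprop => //.
by apply: gen_block gy; rewrite (svalP (e y)) (svalP (e y')).
Qed.

Lemma small_s_seq (t : cardinalType) : ~ injects lambda t -> has_s_seq B t.
Proof.
move=> /large_block [z nz]; apply: (@block_s_seq _ z).
case: (injects_total t {a | block a = z}) => // -[y /injects_trans].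
by move=> /(_ _ (@seg_injects _ y)).
Qed.

Lemma no_ideal_free (R : lambda -> lambda -> Prop) (a : lambda -> B) :
  (forall n m, n < m -> R n m) \/ (forall n m, n < m -> R m n) ->
  ~ ideal_free R a.
Proof.
move=> Rtot aP.
have /choice [U UP] := fun n => ideal_genalg_ultra (proj2 (aP n)).
apply: (@no_separated_ultra R (fun n => val (a n)) U) => //.
- by move=> n; exact: genalgP.
- by move=> n; case: (UP n).
- by move=> n; case: (UP n).
- by move=> n m nm; case: (UP m) => _ _; apply; exists n.
Qed.

Lemma no_hd_seq : ~ has_hd_seq B lambda.
Proof. by move=> [a]; apply: no_ideal_free; left. Qed.

Lemma no_hL_seq : ~ has_hL_seq B lambda.
Proof. by move=> [a]; apply: no_ideal_free; right. Qed.

Lemma s_hd_seq (t : cardinalType) : has_s_seq B t -> has_hd_seq B t.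
Proof.
by move=> [a aP]; exists a; apply: sub_ideal_free aP => y z yz e; rewrite e ltxx in yz.
Qed.

Lemma s_hL_seq (t : cardinalType) : has_s_seq B t -> has_hL_seq B t.
Proof.
by move=> [a aP]; exists a; apply: sub_ideal_free aP => y z yz e; rewrite e ltxx in yz.
Qed.

Lemma s_seq_small (t : cardinalType) : has_s_seq B t -> ~ injects lambda t.
Proof.
move=> [a aP] [e eI]; apply/no_hd_seq/s_hd_seq; exists (a \o e).
exact: ideal_free_inj.
Qed.

Lemma s_plus_B : is_s_plus B lambda.
Proof.
split; first by move=> /s_hd_seq /no_hd_seq.
by move=> t nt; apply/card_leTT; apply: contrapT => /small_s_seq.
Qed.

Lemma hd_plus_B : is_hd_plus B lambda.
Proof.
split; first exact: no_hd_seq.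
by move=> t nt; apply/card_leTT; apply: contrapT => /small_s_seq /s_hd_seq.
Qed.

Lemma hL_plus_B : is_hL_plus B lambda.
Proof.
split; first exact: no_hL_seq.
by move=> t nt; apply/card_leTT; apply: contrapT => /small_s_seq /s_hL_seq.
Qed.

(** By [large_block], no [k] below [lambda] bounds the sizes of all blocks, while each block has
    size below [lambda] and yields a sequence of its own size. *)
Lemma s_B : is_s B lambda.
Proof.
split.
  move=> t /s_seq_small lt; apply/card_leTT.
  case: (injects_total lambda t) => // -[z /injects_trans]; apply; exact: seg_injects.
move=> k kP; apply/card_leTT; apply: contrapT => lk.
have [z nz] := large_block lk.
have lz : ~ injects lambda {a | block a = z}.
  have [y /(_ tt) czy] := cofinality_bounded (fun _ : unit => c z) cf_lambda
    (small_cf (injects_mu_count _)).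
  move=> /injects_trans; apply: contra_not (@seg_noninjects _ y); apply.
  have azy (a : {a | block a = z}) : sval a < y.
    by apply: le_lt_trans (le_block _) _; rewrite (svalP a).
  exists (fun a => exist _ (sval a) (azy a) : seg y).
  by move=> a b /(congr1 val) /=; exact: eq_sig_hprop.
have [t [tz zt]] := card_lt_cardinal lz.
apply: nz; apply: injects_trans zt _.
by apply/card_leTT; apply: kP; exact: block_s_seq tz.
Qed.

End Construction.

Local Open Scope order_scope.
Local Open Scope card_scope.

Theorem theorem5p1
  (mu lambda cflambda : cardinalType) (delta : ordinalType)
  (lam : delta -> cardinalType) (J : set (set delta)) (A : set delta)
  (g : cflambda -> prod_on lam A) (h : lambda -> prod_on lam (~` A))
  (cf_lambda : cofinality lambda cflambda)
  (mu_lt_cf : [set: mu] #< [set: cflambda])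
  (cf_lt_lambda : [set: cflambda] #< [set: lambda])
  (lam_increasing : forall i j, i < j -> [set: lam i] #< [set: lam j])
  (lam_regular : forall i, regular_cardinal (lam i))
  (lam_limit : sup_cardinal (fun k => exists i, k = lam i) mu)
  (J_ideal : is_ideal J)
  (J_bounded : forall X : set delta, (exists j, forall i, X i -> i < j) -> J X)
  (A_notin_J : ~ J A)
  (AC_notin_J : ~ J (~` A)%classic)
  (g_increasing : forall a b, a < b -> lt_mod J (g a) (g b))
  (g_cofinal : forall f : prod_on lam A, exists a, lt_mod J f (g a))
  (h_distinct : injective h)
  (few_restrictions : forall j : delta,
     range (fun a => restr (h a) j) `|` range (fun b => restr (g b) j)
       #< [set: lam j]) :
  exists (d : Order.disp_t) (B : ctbDistrLatticeType d),
    [/\ [set: B] #= [set: lambda], is_s B lambda, is_s_plus B lambda,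
        is_hd_plus B lambda & is_hL_plus B lambda].
Proof.
exists set_display, (B g h cf_lambda); split.
- by eapply B_card; eassumption.
- by eapply s_B; eassumption.
- by eapply s_plus_B; eassumption.
- by eapply hd_plus_B; eassumption.
- by eapply hL_plus_B; eassumption.
Qed.
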